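(* Let $X$ and $Y$ be complex topological vector spaces, let $\Gamma\subset\mathcal{B}(X)$ and $\Gamma_1\subset\mathcal{B}(Y)$, and suppose that $\Gamma$ is quasi-similar to $\Gamma_1$, i.e. there exists a continuous map $\phi: X\to Y$ with dense range such that for every $T\in\Gamma$ there exists $S\in\Gamma_1$ with $S\circ\phi=\phi\circ T$. If $\Gamma$ is topologically transitive in $X$, then $\Gamma_1$ is topologically transitive in $Y$.
   Context: $\mathcal{B}(X)$ denotes the set of all continuous linear operators on $X$. A set $\Gamma\subset\mathcal{B}(X)$ is topologically transitive if for each pair $(U,V)$ of nonempty open subsets of $X$ there exists $T\in\Gamma$ such that $T(U)\cap V\neq\emptyset$. The map $\phi$ is not assumed to be linear. *)

(* Defs.v *)
From HB Require Import structures.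
From mathcomp Require Import all_boot all_order all_algebra.
From mathcomp Require Import complex.
From mathcomp Require Import boolp classical_sets reals topology normedtype.

Set Implicit Arguments.
Unset Strict Implicit.
Unset Printing Implicit Defensive.

Import GRing.Theory.

Local Open Scope classical_set_scope.
Local Open Scope ring_scope.

Definition continuous_operators (K : numDomainType)
    (X : topologicalLmodType K) : set {linear X -> X} :=
  [set T | continuous T].
Arguments continuous_operators {K} X _.

Definition topologically_transitive (K : numDomainType)
    (X : topologicalLmodType K) (Gamma : set {linear X -> X}) : Prop :=
  forall U V : set X, open U -> open V -> U !=set0 -> V !=set0 ->
    exists2 T : {linear X -> X}, Gamma T & (T @` U) `&` V !=set0.

(* The intertwining map [phi] need not be linear. *)
Definition quasi_similar (K : numDomainType) (X Y : topologicalLmodType K)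
    (Gamma : set {linear X -> X}) (Gamma1 : set {linear Y -> Y}) : Prop :=
  exists phi : X -> Y, [/\ continuous phi, dense (range phi) &
    forall T : {linear X -> X}, Gamma T ->
      exists2 S : {linear Y -> Y}, Gamma1 S & S \o phi = phi \o T].

(* Main.v *)
Require Import Defs.
From HB Require Import structures.
From mathcomp Require Import all_boot all_order all_algebra.
From mathcomp Require Import complex.
From mathcomp Require Import boolp classical_sets reals topology normedtype.

Local Open Scope classical_set_scope.
Local Open Scope ring_scope.
Local Open Scope complex_scope.

(** Open sets are pulled back along the intertwining map [phi]: continuity and
    dense range make the preimages of nonempty open sets open and nonempty, so
    some [T] moves a point [x] of the preimage of [U] into the preimage of [V];
    the [S] that intertwines with [T] then moves [phi x], a point of [U], to
    [S (phi x) = phi (T x)], a point of [V]. *)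

(** Dense range does the work of surjectivity when only open sets are pulled
    back. *)
Lemma dense_range_preimage_nonempty (X : Type) (Y : topologicalType)
    (phi : X -> Y) (U : set Y) :
  dense (range phi) -> open U -> U !=set0 -> phi @^-1` U !=set0.
Proof.
move=> phi_dense oU U0; have [y [Uy [x _ phix]]] := phi_dense U U0 oU.
by exists x; rewrite /= phix.
Qed.

Theorem proposition3p3 (R : realType) (X Y : topologicalLmodType R[i])
    (Gamma : set {linear X -> X}) (Gamma1 : set {linear Y -> Y})
    (hGamma : Gamma `<=` continuous_operators X)
    (hGamma1 : Gamma1 `<=` continuous_operators Y)
    (hqs : quasi_similar Gamma Gamma1)
    (htrans : topologically_transitive Gamma) :
  topologically_transitive Gamma1.
Proof.
have [phi [phi_cont phi_dense intertwine]] := hqs.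
move=> U V oU oV U0 V0.
have open_preimage W : open W -> open (phi @^-1` W).
  by move=> oW; apply: open_comp => // x _; apply: phi_cont.
have [T GT [_ [[x Ux <-] VTx]]] := htrans _ _
  (open_preimage _ oU) (open_preimage _ oV)
  (dense_range_preimage_nonempty _ _ _ _ phi_dense oU U0)
  (dense_range_preimage_nonempty _ _ _ _ phi_dense oV V0).
have [S GS S_phi] := intertwine T GT.
exists S => //; exists (S (phi x)); split; first by exists (phi x).
by have /= -> := congr1 (fun f => f x) S_phi.
Qed.
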